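(* Let $p \in [1,\infty)$ and let $w := (w_n)_{n \in \mathbb{N}}$ be a bounded sequence of scalars in $\mathbb{K}$. The unilateral weighted backward shift $$B_w : (x_1,x_2,x_3,\ldots) \in \ell^p(\mathbb{N}) \mapsto (w_1x_2,w_2x_3,\ldots) \in \ell^p(\mathbb{N})$$ is Li-Yorke chaotic if and only if $$\sup\{|w_i \cdots w_j| : i,j \in \mathbb{N}, i \leq j\} = \infty.$$
   Context: $\mathbb{K}$ denotes $\mathbb{R}$ or $\mathbb{C}$, and $\mathbb{N} = \{1,2,3,\ldots\}$. $\ell^p(\mathbb{N})$ is the usual Banach space of $p$-summable $\mathbb{K}$-valued sequences. For $i \leq j$, $w_i\cdots w_j$ denotes the product of all $w_l$ with $i \leq l \leq j$. A continuous map $g : M \to M$ on a metric space $(M,d)$ is Li-Yorke chaotic if there is an uncountable set $S \subset M$ such that for all distinct $x,y \in S$, $\liminf_{n \to \infty} d(g^n(x),g^n(y)) = 0$ and $\limsup_{n\to\infty} d(g^n(x),g^n(y)) > 0$. *)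

(* Defs.v *)
From HB Require Import structures.
From mathcomp Require Import all_boot all_order all_algebra.
From mathcomp Require Import all_classical all_reals all_analysis.
From mathcomp Require Import complex.

Set Implicit Arguments.
Unset Strict Implicit.
Unset Printing Implicit Defensive.

Import Order.TTheory GRing.Theory Num.Theory.
Import numFieldNormedType.Exports.

Local Open Scope classical_set_scope.
Local Open Scope ring_scope.

Definition li_yorke_chaotic (R : realType) (M : metricType R) (g : M -> M) :=
  continuous g /\
  exists S : set M, ~ countable S /\
    forall x y, S x -> S y -> x <> y ->
      limn_einf (fun n => (mdist (iter n g x) (iter n g y))%:E) = 0%E /\
      (0 < limn_esup (fun n => (mdist (iter n g x) (iter n g y))%:E))%E.

Inductive scalar_kind := RealScalars | ComplexScalars.

Definition scalar_field (R : realType) (k : scalar_kind) : fieldType :=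
  match k with RealScalars => R | ComplexScalars => R[i] end.

(* The norm of the numFieldType R[i] takes its values in R[i]; normc is the
   R-valued modulus. *)
Definition sabs (R : realType) (k : scalar_kind) : scalar_field R k -> R :=
  match k with
  | RealScalars => fun a : R => `|a|
  | ComplexScalars => fun z : R[i] => Normc.normc z
  end.

Section sabs_theory.
Context (R : realType) (k : scalar_kind).
Implicit Types a b : scalar_field R k.

Lemma sabs_ge0 a : 0 <= sabs a.
Proof. by case: k a => [a|[a b]] /=; rewrite ?sqrtr_ge0. Qed.

Lemma sabs0 : sabs (0 : scalar_field R k) = 0.
Proof. by case: k => /=; [exact: normr0|exact: Normc.normc0]. Qed.

Lemma sabs1 : sabs (1 : scalar_field R k) = 1.
Proof. by case: k => /=; [exact: normr1|exact: Normc.normc1]. Qed.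

Lemma sabs_eq0 a : sabs a = 0 -> a = 0.
Proof. by case: k a => /= a; [exact: normr0_eq0|exact: Normc.eq0_normc]. Qed.

Lemma sabsD a b : sabs (a + b) <= sabs a + sabs b.
Proof. by case: k a b => /= a b; [exact: ler_normD|exact: le_normcD]. Qed.

Lemma sabsM a b : sabs (a * b) = sabs a * sabs b.
Proof. by case: k a b => /= a b; [exact: normrM|exact: Normc.normcM]. Qed.

Lemma sabsN a : sabs (- a) = sabs a.
Proof. by case: k a => /= a; [exact: normrN|exact: normcN]. Qed.

End sabs_theory.

(* Sequences are indexed from 0: x n is the entry of index n + 1. *)
Section lp_space.
Context (R : realType) (k : scalar_kind) (p : R) (p1 : 1 <= p).
Local Notation K := (scalar_field R k).
Implicit Types x y : nat -> K^o.

Definition lp_enorm x : \bar R :=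
  Lnorm counting p%:E (fun n => (sabs (x n))%:E).

Let p0 : 0 < p. Proof. exact: lt_le_trans p1. Qed.

Lemma lp_enormE x :
  (lp_enorm x = (\sum_(n <oo) (sabs (x n) `^ p)%:E) `^ p^-1)%E.
Proof.
rewrite /lp_enorm Lnorm_counting//; congr (_ `^ _)%E.
by apply: eq_eseriesr => n _ /=; rewrite ger0_norm ?sabs_ge0.
Qed.

Definition lp_mem : {pred nat -> K^o} := [pred x | `[< lp_enorm x < +oo >]%E].

(* The proof of 1 <= p is a parameter of the type because the canonical norm
   and metric on it need the triangle inequality. *)
Record lp (q : 1 <= p) := Lp { lp_seq :> nat -> K^o; _ : lp_seq \in lp_mem }.

HB.instance Definition _ := [isSub for @lp_seq p1].
HB.instance Definition _ := [Choice of lp p1 by <:].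

Lemma lp_memP x : x \in lp_mem <-> (lp_enorm x < +oo)%E.
Proof. by split=> [/asboolP|h]; [|apply/asboolP]. Qed.

Lemma lp_enorm_ge0 x : (0 <= lp_enorm x)%E.
Proof. exact: Lnorm_ge0. Qed.

Let psum_ge0 (f : nat -> R) : (0 <= \sum_(n <oo) (f n `^ p)%:E)%E.
Proof. by apply: nneseries_ge0 => n _ _; rewrite lee_fin powR_ge0. Qed.

Let le_psum (f g : nat -> R) : (forall n, 0 <= f n) ->
  (forall n, f n <= g n) ->
  ((\sum_(n <oo) (f n `^ p)%:E) `^ p^-1 <=
   (\sum_(n <oo) (g n `^ p)%:E) `^ p^-1)%E.
Proof.
move=> f0 fg; apply: gt0_ler_poweR; rewrite ?invr_ge0 ?(ltW p0)//.
- by rewrite in_itv/= psum_ge0 leey.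
- by rewrite in_itv/= psum_ge0 leey.
apply: lee_nneseries => [n _ _|n _]; first by rewrite lee_fin powR_ge0.
by rewrite lee_fin ge0_ler_powR ?nnegrE ?(ltW p0)// (le_trans (f0 n)).
Qed.

Lemma le_lp_enorm x y :
  (forall n, sabs (x n) <= sabs (y n)) -> (lp_enorm x <= lp_enorm y)%E.
Proof. by move=> xy; rewrite !lp_enormE le_psum// => n; exact: sabs_ge0. Qed.

Lemma lp_enormD x y : (lp_enorm (x + y)%R <= lp_enorm x + lp_enorm y)%E.
Proof.
pose f n := sabs (x n); pose g n := sabs (y n).
apply: (@le_trans _ _ (Lnorm counting p%:E (EFin \o (f \+ g)))); last first.
  exact: minkowski_EFin.
rewrite Lnorm_counting// lp_enormE.
rewrite [leRHS](_ : _ = (\sum_(n <oo) ((f n + g n) `^ p)%:E) `^ p^-1)%E.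
  by apply: le_psum => n; [exact: sabs_ge0|exact: sabsD].
congr (_ `^ _)%E; apply: eq_eseriesr => n _ /=.
by rewrite ger0_norm ?addr_ge0 ?sabs_ge0.
Qed.

Lemma lp_enormZ (a : K) x : lp_enorm (a *: x) = ((sabs a)%:E * lp_enorm x)%E.
Proof.
rewrite !lp_enormE; under eq_eseriesr => n _.
  rewrite (_ : sabs _ = sabs a * sabs (x n)); last exact: sabsM.
  by rewrite powRM ?sabs_ge0// EFinM; over.
rewrite nneseriesZl; last by move=> n _; rewrite lee_fin powR_ge0.
rewrite poweRM ?lee_fin ?powR_ge0//; congr *%E.
by rewrite -poweR_EFin -poweRrM mulfV ?gt_eqF// poweRe1// lee_fin sabs_ge0.
Qed.

Lemma lp_mem_psum x :
  x \in lp_mem <-> (\sum_(n <oo) (sabs (x n) `^ p)%:E < +oo)%E.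
Proof.
apply: (iff_trans (lp_memP x)); rewrite lp_enormE; split.
  by apply: lty_poweRy; rewrite invr_neq0// gt_eqF.
exact: poweR_lty.
Qed.

Lemma lp_mem_submod_closed : submod_closed lp_mem.
Proof.
split.
  apply/lp_memP; rewrite -(scale0r (0 : nat -> K^o)) lp_enormZ sabs0 mul0e.
  exact: ltry.
move=> a x y /lp_memP xoo /lp_memP yoo; apply/lp_memP.
rewrite (le_lt_trans (lp_enormD _ _))// lp_enormZ lte_add_pinfty//.
by rewrite lte_mul_pinfty// ?lee_fin ?sabs_ge0.
Qed.

HB.instance Definition _ :=
  GRing.isSubmodClosed.Build K (nat -> K^o) lp_mem lp_mem_submod_closed.
HB.instance Definition _ := [SubChoice_isSubLmodule of lp p1 by <:].

Definition lp_norm (x : lp p1) : R := fine (lp_enorm x).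

Lemma lp_normK (x : lp p1) : (lp_norm x)%:E = lp_enorm x.
Proof.
rewrite fineK// ge0_fin_numE ?lp_enorm_ge0//.
by apply/lp_memP; exact: valP x.
Qed.

Lemma lp_normD (x y : lp p1) : lp_norm (x + y) <= lp_norm x + lp_norm y.
Proof. by rewrite -lee_fin EFinD !lp_normK; exact: lp_enormD. Qed.

Lemma lp_normZ (a : K) (x : lp p1) : lp_norm (a *: x) = sabs a * lp_norm x.
Proof. by apply: EFin_inj; rewrite EFinM !lp_normK; exact: lp_enormZ. Qed.

Lemma lp_normN (x : lp p1) : lp_norm (- x) = lp_norm x.
Proof. by rewrite -scaleN1r lp_normZ sabsN sabs1 mul1r. Qed.

Lemma lp_norm_eq0 (x : lp p1) : lp_norm x = 0 -> x = 0.
Proof.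
move=> xE; have := lp_normK x; rewrite xE lp_enormE => /esym.
move/(poweR_eq0_eq0 (psum_ge0 _)) => x0.
apply/val_inj/funext => n /=; apply: sabs_eq0.
suff : (sabs (x n) `^ p)%:E = 0%E by move=> [/powR_eq0_eq0].
apply/eqP; rewrite eq_le; apply/andP; split; last by rewrite lee_fin powR_ge0.
rewrite -x0 (@nneseriesD1 _ _ n predT)// ?leeDl//; last first.
  by move=> *; rewrite lee_fin powR_ge0.
by apply: nneseries_ge0 => *; rewrite lee_fin powR_ge0.
Qed.

Let lp_mulr_natl (x : lp p1) n : x *+ n = (n%:R : K) *: x.
Proof. by rewrite scaler_nat. Qed.

Let sabs_nat n : sabs (n%:R : K) = n%:R.
Proof.
case: k => /=; first by rewrite normr_nat.
by rewrite [LHS]normcMn Normc.normc1.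
Qed.

Lemma lp_normMn (x : lp p1) n : lp_norm (x *+ n) = lp_norm x *+ n.
Proof. by rewrite lp_mulr_natl lp_normZ sabs_nat mulr_natl. Qed.

HB.instance Definition _ := Num.Zmodule_isNormed.Build R (lp p1)
  lp_normD lp_norm_eq0 lp_normMn lp_normN.

Definition lp_dist (x y : lp p1) : R := `|x - y|.

Let lp_dist_xx (x : lp p1) : lp_dist x x = 0.
Proof. by rewrite /lp_dist subrr normr0. Qed.

Let lp_dist_eq0 (x y : lp p1) : lp_dist x y = 0 -> x = y.
Proof. by move/normr0_eq0/eqP; rewrite subr_eq0 => /eqP. Qed.

Let lp_distC (x y : lp p1) : lp_dist x y = lp_dist y x.
Proof. exact: distrC. Qed.

Let lp_dist_triangle (y x z : lp p1) : lp_dist x z <= lp_dist x y + lp_dist y z.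
Proof. exact: ler_distD. Qed.

HB.instance Definition _ := isMetric.Build R (lp p1)
  lp_dist_xx lp_dist_eq0 lp_distC lp_dist_triangle.
HB.instance Definition _ := isPointed.Build (lp p1) 0.

Let mdist_lp_norm (x y : lp p1) : mdist x y = `|y - x|.
Proof. exact: distrC. Qed.

HB.instance Definition _ := NormedZmoduleMetric.Build R (lp p1) mdist_lp_norm.

Lemma lp_normE (x : lp p1) : `|x| = lp_norm x.
Proof. by []. Qed.

Lemma lp_mdistE (x y : lp p1) : mdist x y = lp_norm (x - y).
Proof. by []. Qed.

End lp_space.

Section weighted_shift.
Context (R : realType) (k : scalar_kind) (p : R) (p1 : 1 <= p).
Local Notation K := (scalar_field R k).
Implicit Types (w : nat -> K) (x : nat -> K^o).

Definition bounded_weights w := exists M : R, forall n, sabs (w n) <= M.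

Definition shift_seq w x : nat -> K^o := fun n => w n * x n.+1.

Lemma shift_seq_lp w x :
  bounded_weights w -> x \in lp_mem p -> shift_seq w x \in lp_mem p.
Proof.
move=> [M wM] /(lp_mem_psum p1) xoo; apply/(lp_mem_psum p1).
have p0 : 0 <= p by exact: le_trans p1.
have M0 : 0 <= M by exact: le_trans (sabs_ge0 (w 0%N)) (wM 0%N).
pose u n := (sabs (x n) `^ p)%:E.
have u0 n : (0 <= u n)%E by rewrite lee_fin powR_ge0.
apply: (@le_lt_trans _ _ ((M `^ p)%:E * \sum_(n <oo) u (n + 1)%N)%E).
  rewrite -nneseriesZl//; apply: lee_nneseries => [n _ _|n _].
    by rewrite lee_fin powR_ge0.
  rewrite /u -EFinM lee_fin addn1 -powRM ?sabs_ge0//.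
  rewrite ge0_ler_powR ?nnegrE ?mulr_ge0 ?sabs_ge0// sabsM.
  by rewrite ler_wpM2r ?sabs_ge0.
rewrite nneseries_addn// lte_mul_pinfty ?lee_fin ?powR_ge0//.
apply: le_lt_trans xoo; rewrite (@nneseries_recl _ predT u)//.
by rewrite leeDr.
Qed.

Definition weighted_shift w (hw : bounded_weights w) (x : lp k p1) : lp k p1 :=
  Lp p1 (shift_seq_lp hw (valP x)).

End weighted_shift.

Arguments weighted_shift {R k p} p1 {w} hw x.

(* Main.v *)
Require Import Defs.
From mathcomp Require Import all_boot all_order all_algebra.
From mathcomp Require Import all_classical all_reals all_analysis.
From mathcomp Require Import complex lra.

(** The iterate [B^n] sends [x] to the sequence with [j]-th entry
[w_j ... w_(j+n-1) x_(j+n)].  If all products of consecutive weights are bounded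
by [C], then [|B^(n+m) z| <= C |B^n z|], so a zero limit inferior of [|B^n z|]
forces a zero limit superior.  If they are unbounded, products
[P_q = w_(lo q) ... w_(pos q - 1)] can be chosen inductively, each so large
compared with the powers of the weight bound up to [pos (q-1) + 1] that the vector
[x = sum_q P_q^-1 e_(pos q)] satisfies [|B^(pos q + 1) x| -> 0], while
[B^(pos q - lo q) x] has an entry equal to 1.  The real multiples of [x] then form
an uncountable scrambled set. *)

Set Implicit Arguments.
Unset Strict Implicit.

Import Order.TTheory GRing.Theory Num.Theory.
Import numFieldNormedType.Exports.
Local Open Scope classical_set_scope.
Local Open Scope ring_scope.

(** * Limits inferior and superior of real sequences *)

Section limits_inferior_superior.
Context (R : realType) (u : nat -> R).

(** The limit inferior is the supremum of the tail infima, so the infimum over all indices is at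
    most 0. *)
Lemma limn_einf0_lt (e : R) :
  limn_einf (fun n => (u n)%:E) = 0%E -> 0 < e -> exists n, u n < e.
Proof.
move=> u0 e0.
have : (einfs (fun n => (u n)%:E) 0%N < e%:E)%E.
  apply: (@le_lt_trans _ _ 0%E); last by rewrite lte_fin.
  rewrite -u0 limn_einf_lim.
  rewrite (@cvg_lim _ (@ereal_hausdorff R) _ _ _ _ _ (@cvg_einfs_sup R _)).
  by apply: ereal_sup_ubound; exists 0%N.
by move=> /ereal_inf_lt [_ [n _ <-]]; rewrite lte_fin => une; exists n.
Qed.

Lemma limn_einf_eq0 : (forall n, 0 <= u n) ->
    (forall n e, 0 < e -> exists2 m, (n <= m)%N & u m <= e) ->
  limn_einf (fun n => (u n)%:E) = 0%E.
Proof.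
move=> u_ge0 u_small; rewrite limn_einf_lim.
rewrite [X in limn X](_ : _ = cst 0%E) ?lim_cst//; apply/funext => n /=.
apply/eqP; rewrite eq_le; apply/andP; split; last first.
  by apply: le_ereal_inf_tmp => _ [m _ <-]; rewrite lee_fin.
apply/lee_addgt0Pr => e e0; rewrite add0e.
have [m nm ume] := u_small n e e0.
apply: ge_ereal_inf; exists (u m)%:E; last by rewrite lee_fin.
by exists m.
Qed.

Lemma limn_esup_ge (c : R) : (forall n, exists2 m, (n <= m)%N & c <= u m) ->
  (c%:E <= limn_esup (fun n => (u n)%:E))%E.
Proof.
move=> u_large; rewrite limn_esup_lim; apply: lime_ge.
  exact: is_cvg_esups.
apply: nearW => n; have [m nm cum] := u_large n.
apply: (@le_trans _ _ (u m)%:E); first by rewrite lee_fin.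
by apply: ereal_sup_ubound; exists m.
Qed.

Lemma limn_esup_le (c : R) n : (forall m, (n <= m)%N -> u m <= c) ->
  (limn_esup (fun n => (u n)%:E) <= c%:E)%E.
Proof.
move=> uc; rewrite limn_esup_lim.
rewrite (@cvg_lim _ (@ereal_hausdorff R) _ _ _ _ _ (@cvg_esups_inf R _)).
apply: ge_ereal_inf; exists (esups (fun n => (u n)%:E) n); first by exists n.
by apply: ge_ereal_sup => _ [m /= nm <-]; rewrite lee_fin uc.
Qed.

End limits_inferior_superior.

(** * Real scalars inside either scalar field *)

Definition real_scalar {R : realType} (k : scalar_kind) : R -> scalar_field R k :=
  match k with
  | RealScalars => id
  | ComplexScalars => fun a => a%:C%C
  end.

Section real_scalar.
Context (R : realType) (k : scalar_kind).

Lemma real_scalarB (a b : R) :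
  real_scalar k (a - b) = real_scalar k a - real_scalar k b.
Proof. by case: k => //=; rewrite rmorphB. Qed.

Lemma sabs_real_scalar (a : R) : sabs (real_scalar k a) = `|a|.
Proof. by case: k => //=; rewrite expr0n/= addr0 sqrtr_sqr. Qed.

Lemma sabsV (a : scalar_field R k) : sabs a^-1 = (sabs a)^-1.
Proof.
have [->|a0] := eqVneq a 0; first by rewrite invr0 sabs0 invr0.
have sa0 : sabs a != 0 by apply: contra_neq a0; exact: sabs_eq0.
by apply: (mulfI sa0); rewrite -sabsM !divff// sabs1.
Qed.

End real_scalar.

(** * Norm estimates for sequences *)

Section lp_estimates.
Context (R : realType) (k : scalar_kind) (p : R) (p1 : 1 <= p).
Local Notation K := (scalar_field R k).
Implicit Types x y : nat -> K^o.

Let p_gt0 : 0 < p. Proof. exact: lt_le_trans p1. Qed.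

(** The [l^1] norm dominates the [l^p] norm: each [|x_m|] is at most [s], so
    [|x_m|^p <= |x_m| s^(p-1)], and summing gives at most [s^p]. *)
Lemma lp_enorm_le_sum x (s : R) :
  (forall N, \sum_(0 <= m < N) sabs (x m) <= s) -> (lp_enorm p x <= s%:E)%E.
Proof.
wlog s0 : s / 0 < s => [gt0_bound sum_le|sum_le].
  have s_ge0 : 0 <= s by have := sum_le 0%N; rewrite big_geq.
  apply/lee_addgt0Pr => e e0; rewrite -EFinD; apply: gt0_bound => [|N].
    by rewrite ltr_wpDl.
  by rewrite (le_trans (sum_le N))// lerDl ltW.
have x_le m : sabs (x m) <= s.
  apply: le_trans (sum_le m.+1); rewrite big_nat_recr//= lerDr.
  by apply: sumr_ge0 => i _; exact: sabs_ge0.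
have sE : s%:E = ((s `^ p)%:E `^ p^-1)%E.
  by rewrite poweR_EFin -powRrM divff ?gt_eqF// powRr1// ltW.
rewrite lp_enormE// sE; apply: gt0_ler_poweR.
- by rewrite invr_ge0 ltW.
- rewrite in_itv/= leey andbT.
  by apply: nneseries_ge0 => n _ _; rewrite lee_fin powR_ge0.
- by rewrite in_itv/= leey andbT lee_fin powR_ge0.
apply: lime_le.
  by apply: is_cvg_nneseries => n _ _; rewrite lee_fin powR_ge0.
apply: nearW => N; rewrite sumEFin lee_fin -mulr_powRB1 ?(ltW s0)//.
apply: le_trans (ler_wpM2r (powR_ge0 _ _) (sum_le N)).
rewrite mulr_suml; apply: ler_sum => m _.
rewrite -mulr_powRB1 ?sabs_ge0// ler_wpM2l ?sabs_ge0//.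
by rewrite ge0_ler_powR ?nnegrE ?sabs_ge0 ?subr_ge0// ltW.
Qed.

Lemma sabs_le_lp_norm (x : lp k p1) n : sabs (x n) <= lp_norm x.
Proof.
rewrite -lee_fin lp_normK lp_enormE//.
have -> : (sabs (x n))%:E = ((sabs (x n) `^ p)%:E `^ p^-1)%E.
  by rewrite poweR_EFin -powRrM divff ?gt_eqF// powRr1// sabs_ge0.
apply: gt0_ler_poweR.
- by rewrite invr_ge0 ltW.
- by rewrite in_itv/= leey andbT lee_fin powR_ge0.
- rewrite in_itv/= leey andbT.
  by apply: nneseries_ge0 => m _ _; rewrite lee_fin powR_ge0.
rewrite (@nneseriesD1 _ _ n predT)// ?leeDl//; last first.
  by move=> *; rewrite lee_fin powR_ge0.
by apply: nneseries_ge0 => *; rewrite lee_fin powR_ge0.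
Qed.

Lemma lp_enorm_drop x n :
  (lp_enorm p (fun j => x (j + n)%N) <= lp_enorm p x)%E.
Proof.
rewrite !lp_enormE//; apply: gt0_ler_poweR.
- by rewrite invr_ge0 ltW.
- rewrite in_itv/= leey andbT.
  by apply: nneseries_ge0 => m _ _; rewrite lee_fin powR_ge0.
- rewrite in_itv/= leey andbT.
  by apply: nneseries_ge0 => m _ _; rewrite lee_fin powR_ge0.
rewrite (nneseries_addn (f := fun j => (sabs (x j) `^ p)%:E)); last first.
  by move=> m; rewrite lee_fin powR_ge0.
rewrite [leRHS](@nneseries_split _ _ 0 n) ?add0n; last first.
  by move=> m _; rewrite lee_fin powR_ge0.
by rewrite leeDr// sume_ge0// => m _; rewrite lee_fin powR_ge0.
Qed.

End lp_estimates.

(** * Iterates of the shift and its continuity *)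

Section weighted_shift_iterates.
Context (R : realType) (k : scalar_kind) (p : R) (p1 : 1 <= p).
Local Notation K := (scalar_field R k).
Context (w : nat -> K) (hw : bounded_weights w).
Local Notation B := (weighted_shift p1 hw).

Lemma iter_weighted_shiftE (x : lp k p1) n j :
  iter n B x j = (\prod_(j <= l < j + n) w l) * x (j + n)%N.
Proof.
elim: n j => [|n IHn] j; first by rewrite addn0 big_geq// mul1r.
rewrite [LHS](_ : _ = w j * iter n B x j.+1)// IHn mulrA addSnnS.
by rewrite [in RHS]big_ltn// -addSnnS leq_addr.
Qed.

Lemma iter_weighted_shiftB (x y : lp k p1) n :
  iter n B x - iter n B y = iter n B (x - y).
Proof.
apply/val_inj/funext => j.
rewrite [LHS](_ : _ = iter n B x j - iter n B y j)//.
rewrite [RHS](_ : _ = iter n B (x - y) j)// !iter_weighted_shiftE.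
exact/esym/(mulrBr (\prod_(j <= l < j + n) w l : K)).
Qed.

Lemma iter_weighted_shiftZ (a : K) (x : lp k p1) n :
  iter n B (a *: x) = a *: iter n B x.
Proof.
apply/val_inj/funext => j.
rewrite [LHS](_ : _ = iter n B (a *: x) j)//.
rewrite [RHS](_ : _ = a * iter n B x j)// !iter_weighted_shiftE.
exact: (mulrCA (\prod_(j <= l < j + n) w l : K)).
Qed.

Lemma mdist_iter_weighted_shift (x y : lp k p1) n :
  mdist (iter n B x) (iter n B y) = lp_norm (iter n B (x - y)).
Proof. by rewrite lp_mdistE iter_weighted_shiftB. Qed.

(** Entrywise, [B^n x] is dominated by [C] times [x] with its first [n] entries dropped, and
    dropping entries does not increase the norm. *)
Lemma le_lp_norm_iter (C : R) n (x : lp k p1) : 0 <= C ->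
    (forall j, sabs (\prod_(j <= l < j + n) w l) <= C) ->
  lp_norm (iter n B x) <= C * lp_norm x.
Proof.
move=> C0 prodC; rewrite -lee_fin EFinM !lp_normK.
have -> : C = sabs (real_scalar k C) by rewrite sabs_real_scalar ger0_norm.
rewrite -lp_enormZ//.
refine (le_trans _ (lp_enorm_drop p1 _ n)).
apply: le_lp_enorm => // j.
rewrite iter_weighted_shiftE sabsM [leRHS]sabsM.
by rewrite sabs_real_scalar ger0_norm// ler_wpM2r ?sabs_ge0.
Qed.

Lemma continuous_weighted_shift : continuous B.
Proof.
have [M wM] := hw.
have M0 : 0 <= M by exact: le_trans (sabs_ge0 (w 0%N)) (wM 0%N).
move=> x.
apply/(@metricType_numDomainType.cvgrPdist_lt _ (lp k p1) _ (nbhs x)) => e e0.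
(* The bound [M] may be 0; [M + 1] is a Lipschitz constant that can be divided by. *)
have M1 : 0 < M + 1 by rewrite ltr_wpDl.
apply/metricType_numDomainType.nbhs_mdistP.
exists (e / (M + 1)) => [|y /=]; first exact: divr_gt0.
rewrite ltr_pdivlMr// mulrC; apply: le_lt_trans.
rewrite (mdist_iter_weighted_shift x y 1) lp_mdistE.
apply: le_lp_norm_iter; first exact: ltW.
by move=> j; rewrite addn1 big_nat1 (le_trans (wM j))// lerDl.
Qed.

(** * Necessity: chaos forces unbounded products *)

Lemma li_yorke_chaotic_products_unbounded : li_yorke_chaotic B ->
  ereal_sup [set (sabs (\prod_(ij.1 <= l < ij.2.+1) w l))%:E
            | ij in [set ij : nat * nat | (ij.1 <= ij.2)%N]] = +oo%E.
Proof.
move=> [_ [S [S_unc chaos]]]; apply: contrapT => sup_fin.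
(* Taking [C >= 1] also covers the empty product, which arises for [n = 0]. *)
have [C C1 prodC] : exists2 C : R, 1 <= C &
    forall n j, sabs (\prod_(j <= l < j + n) w l) <= C.
  have [C C1 supC] : exists2 C : R, 1 <= C &
      forall i j, (i <= j)%N -> sabs (\prod_(i <= l < j.+1) w l) <= C.
    apply: contrapT => noC; apply: sup_fin; apply/eqyP => A A0.
    rewrite leNgt; apply/negP => supA; apply: noC.
    exists (A + 1); first by rewrite lerDr ltW.
    move=> i j ij; rewrite (@le_trans _ _ A) ?lerDl//.
    rewrite -lee_fin; apply: le_trans (ltW supA).
    by apply: ereal_sup_ubound; exists (i, j).
  exists C => // -[|n] j; first by rewrite addn0 big_geq// sabs1.
  by rewrite addnS supC// leq_addr.
have C0 : 0 < C by exact: lt_le_trans C1.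
have [x [y [Sx Sy xy]]] : exists x y, [/\ S x, S y & x <> y].
  apply: contrapT => S_le1; apply: S_unc.
  have [[x Sx]|S0] := pselect (S !=set0).
    apply: sub_countable (countable1 x); apply: subset_card_le => y Sy /=.
    by apply: contrapT => yx; apply: S_le1; exists y, x.
  apply: sub_countable (@countable0 (lp k p1)); apply: subset_card_le => y Sy.
  by case: S0; exists y.
have [liminf0 limsup_gt0] := chaos x y Sx Sy xy.
suff : (limn_esup (fun n => (mdist (iter n B x) (iter n B y))%:E) <= 0)%E.
  by rewrite leNgt limsup_gt0.
apply/lee_addgt0Pr => e e0; rewrite add0e.
(* Once a distance is below [e / C], all later ones are at most [C * (e / C) = e]. *)
have [n dist_n] := limn_einf0_lt liminf0 (divr_gt0 e0 C0).
apply: (@limn_esup_le _ _ _ n) => m nm.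
rewrite mdist_iter_weighted_shift -(subnK nm) iterD.
apply: le_trans (le_lp_norm_iter _ (ltW C0) (prodC _)) _.
by rewrite mulrC -ler_pdivlMr// ltW// -mdist_iter_weighted_shift.
Qed.

End weighted_shift_iterates.

(** * Sparse sums and geometric tails *)

Section real_sums.
Context (R : realType).

(** After exchanging the sums, each [q] meets at most one [m], and meets one only if
    [r <= pos q]. *)
Lemma sum_sparse_le (pos : nat -> nat) (a : nat -> R) (r N T : nat) :
    (forall q, 0 <= a q) ->
  \sum_(m < N) \sum_(q < T | pos q == (m + r)%N) a q <=
  \sum_(q < T | (r <= pos q)%N) a q.
Proof.
move=> a0; rewrite (exchange_big_dep predT)//= [leRHS]big_mkcond/=.
apply: ler_sum => q _; case: (pickP (fun m : 'I_N => pos q == (m + r)%N)).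
  move=> m0 /eqP qm0; rewrite (big_pred1 m0) => [|m]; last first.
    by rewrite qm0 eqn_add2r eq_sym.
  by rewrite qm0 leq_addl.
by move=> no_m; rewrite big_pred0//; case: ifP.
Qed.

Lemma sum_pow_half_le (n T : nat) :
  \sum_(q < T | (n <= q)%N) 2^-1 ^+ q <= 2 * 2^-1 ^+ n :> R.
Proof.
(* The closed form uses [maxn n T] so that it gives 0 for the empty sum, when [T <= n]. *)
suff -> : \sum_(q < T | (n <= q)%N) 2^-1 ^+ q =
    2 * 2^-1 ^+ n - 2 * 2^-1 ^+ maxn n T :> R.
  by rewrite gerBl mulr_ge0// exprn_ge0.
elim: T => [|T IHT]; first by rewrite big_ord0 maxn0 subrr.
rewrite big_mkcond big_ord_recr/= -big_mkcond IHT.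
case: (leqP n T) => nT.
  rewrite (maxn_idPr (leqW nT)) exprS mulrA divff// mul1r.
  by rewrite mulr_natl mulr2n; lra.
by rewrite (maxn_idPl nT) addr0.
Qed.

End real_sums.

(** * Construction of the irregular vector *)

Section irregular_vector.
Context (R : realType) (k : scalar_kind).
Local Notation K := (scalar_field R k).
Context (w : nat -> K) (M : R).
Hypothesis M1 : 1 <= M.
Hypothesis wM : forall n, sabs (w n) <= M.
Hypothesis unbounded : forall A : R,
  exists2 ij : nat * nat, (ij.1 <= ij.2)%N &
    A <= sabs (\prod_(ij.1 <= l < ij.2.+1) w l).

Let M0 : 0 < M. Proof. exact: lt_le_trans M1. Qed.

Lemma sabs_prod_le i n : sabs (\prod_(i <= l < i + n) w l) <= M ^+ n.
Proof.
elim: n => [|n IHn]; first by rewrite addn0 big_geq// sabs1 expr0.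
rewrite addnS big_nat_recr ?leq_addr//= sabsM exprSr.
by rewrite ler_pM ?sabs_ge0.
Qed.

(** The bounds are on [l^1] sums, so one construction serves every [p]. They give, in turn,
    membership in [l^p], small iterates at arbitrarily late times, and iterates with an entry 1 at
    arbitrarily late times. *)
Lemma irregular_sequence : exists x : nat -> K^o,
  [/\ forall N, \sum_(0 <= m < N) sabs (x m) <= 2,
  forall c, exists2 r, (c <= r)%N & forall N,
    \sum_(0 <= m < N) sabs ((\prod_(m <= l < m + r) w l) * x (m + r)%N)
      <= 2 * 2^-1 ^+ c &
  forall c, exists2 t, (c <= t)%N & exists i,
    (\prod_(i <= l < i + t) w l) * x (i + t)%N = 1].
Proof.
have [f fP] : {f : nat -> nat * nat & forall r, ((f r).1 <= (f r).2)%N /\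
    (2 * M) ^+ r <= sabs (\prod_((f r).1 <= l < (f r).2.+1) w l)}.
  apply: (@choice _ _ (fun r ij => (ij.1 <= ij.2)%N /\
    (2 * M) ^+ r <= sabs (\prod_(ij.1 <= l < ij.2.+1) w l))) => r.
  by have [ij ij_le le_P] := unbounded ((2 * M) ^+ r); exists ij.
(* The recursion reads [r 0 = 0] and [r (q + 1) = pos q + 1]: this many shifts just push out the
   entry at [pos q]. The exponent [r q] also prescribes the size of the next product. *)
pose r q := iter q (fun r => (f r).2.+2) 0%N.
pose lo q := (f (r q)).1; pose pos q := (f (r q)).2.+1.
pose P q := \prod_(lo q <= l < pos q) w l.
have lo_pos q : (lo q < pos q)%N by rewrite ltnS; have [] := fP (r q).
have P_ge q : (2 * M) ^+ r q <= sabs (P q) by have [] := fP (r q).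
have rS q : r q.+1 = (pos q).+1 by [].
have M2_gt1 : 1 < 2 * M.
  by rewrite (le_lt_trans M1)// ltr_pMl// ltr1n.
have M2_gt0 : 0 < 2 * M by exact: lt_trans M2_gt1.
(* A product of [n] weights is at most [M ^+ n], so [P q] must be long. *)
have r_le q : (r q <= pos q - lo q)%N.
  rewrite leqNgt; apply/negP => short.
  have := sabs_prod_le (lo q) (pos q - lo q).
  rewrite subnKC ?(ltnW (lo_pos q))// => /(le_trans (P_ge q)).
  apply/negP; rewrite -ltNge.
  apply: (@lt_le_trans _ _ ((2 * M) ^+ (pos q - lo q).+1)); last first.
    by rewrite ler_weXn2l// ltW.
  apply: (@le_lt_trans _ _ ((2 * M) ^+ (pos q - lo q))).
    by rewrite lerXn2r ?nnegrE ?(ltW M0) ?(ltW M2_gt0)// ler_peMl ?ler1n// ltW.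
  by rewrite exprS ltr_pMl// exprn_gt0.
have r_pos q : (r q <= pos q)%N by rewrite (leq_trans (r_le q))// leq_subr.
have r_homo : {homo r : q q' / (q <= q')%N}.
  apply: homo_leq leqnn leq_trans _ => q.
  by rewrite rS (leq_trans (r_pos q)).
have id_le_r q : (q <= r q)%N.
  by elim: q => // q IHq; rewrite rS ltnS (leq_trans IHq).
have pos_lt q q' : (q < q')%N -> (pos q < pos q')%N.
  by move=> qq'; rewrite (leq_trans _ (r_pos q'))// -rS r_homo.
(* Only the terms of index at least [q] survive [r q] shifts. *)
have r_le_pos q q' : (r q <= pos q')%N -> (q <= q')%N.
  by apply: contraTT; rewrite -!ltnNge => qq'; rewrite -rS r_homo.
have pos_inj q q' : pos q = pos q' -> q = q'.
  by case: (ltngtP q q') => // /pos_lt + qq'; rewrite qq' ltnn.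
have id_le_pos q : (q <= pos q)%N by rewrite (leq_trans (id_le_r q)).
pose a q := (sabs (P q))^-1.
have a_ge0 q : 0 <= a q by rewrite invr_ge0 sabs_ge0.
have P_gt0 q : 0 < sabs (P q).
  by apply: lt_le_trans (P_ge q); rewrite exprn_gt0.
have P_neq0 q : P q != 0.
  by apply: contraTneq (P_gt0 q) => ->; rewrite sabs0 ltxx.
(* Since [|P q| >= (2M)^(r q)] and [r q' <= r q], the left side is at most [2^-(r q)], and
   [q <= r q]. *)
have Ma q' q : (q' <= q)%N -> M ^+ r q' * a q <= 2^-1 ^+ q.
  move=> qq'; apply: (@le_trans _ _ (M ^+ r q / (2 * M) ^+ r q)).
    rewrite ler_pM// ?exprn_ge0 ?(ltW M0)//; first by rewrite ler_weXn2l// r_homo.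
    by rewrite /a lef_pV2 ?posrE// exprn_gt0.
  rewrite exprMn invfM mulrCA divff ?mulr1; last by rewrite gt_eqF ?exprn_gt0.
  by rewrite exprVn lef_pV2 ?posrE ?exprn_gt0// ler_weXn2l// ler1n.
(* The range [q <= m] misses no term because [q <= pos q]; injectivity of [pos] leaves at most one
   term. *)
pose x m : K^o := \sum_(q < m.+1 | pos q == m) (P q)^-1.
have x_le T m : (m < T)%N -> sabs (x m) <= \sum_(q < T | pos q == m) a q.
  move=> mT; apply: (@le_trans _ _ (\sum_(q < m.+1 | pos q == m) a q)).
    rewrite /x; elim/big_ind2 : _ => [|u u' v v' uu' vv'|q _].
    - by rewrite sabs0.
    - by apply: le_trans (sabsD _ _) _; exact: lerD.
    - by rewrite sabsV.
  rewrite (big_ord_widen_cond T (fun q => pos q == m) a)//.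
  rewrite [leRHS]big_mkcond [leLHS]big_mkcond; apply: ler_sum => q _.
  by case: (pos q == m) => //=; case: ifP.
have xpos q : x (pos q) = (P q)^-1.
  have qpos : (q < (pos q).+1)%N by rewrite ltnS.
  rewrite /x (big_pred1 (Ordinal qpos))// => q' /=.
  by apply/eqP/eqP => [/pos_inj q'q|-> //]; exact: val_inj.
(* Each weight product is at most [M^(r c)], and the surviving terms have index at least [c], so
   [Ma] reduces the sum to a geometric tail. *)
have tail c N : \sum_(0 <= m < N)
    sabs ((\prod_(m <= l < m + r c) w l) * x (m + r c)%N) <= 2 * 2^-1 ^+ c.
  apply: (@le_trans _ _ (M ^+ r c * \sum_(m < N)
      \sum_(q < N + r c | pos q == (m + r c)%N) a q)).
    rewrite big_mkord mulr_sumr; apply: ler_sum => m _.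
    rewrite sabsM ler_pM ?sabs_ge0 ?sabs_prod_le// x_le//.
    by rewrite ltn_add2r.
  have Mr_ge0 : 0 <= M ^+ r c by rewrite exprn_ge0// ltW.
  apply: le_trans
    (ler_wpM2l Mr_ge0 (@sum_sparse_le R pos a (r c) N (N + r c) a_ge0)) _.
  apply: (le_trans _ (sum_pow_half_le R c (N + r c))).
  rewrite mulr_sumr big_mkcond [leRHS]big_mkcond; apply: ler_sum => q _.
  case: ifPn => [/r_le_pos cq|_]; first by rewrite cq Ma.
  by case: ifP => // _; rewrite exprn_ge0.
exists x; split=> [N|c|c].
(* As [r 0 = 0], the tail estimate for [c = 0] has empty products and bounds the sum of [x]
   itself. *)
- have := tail 0%N N; rewrite expr0 mulr1; congr (_ <= _).
  by apply: eq_bigr => m _; rewrite addn0 big_geq// mul1r.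
- by exists (r c).
(* This many shifts bring the entry at [pos c] to [lo c], where it becomes [P c * (P c)^-1]. *)
exists (pos c - lo c)%N; first by rewrite (leq_trans (id_le_r c)).
exists (lo c); rewrite subnKC ?(ltnW (lo_pos c))// xpos.
exact: (divff (P_neq0 c)).
Qed.

End irregular_vector.

(** A countable set has Lebesgue measure 0, while the line has infinite measure. *)
Lemma real_uncountable (R : realType) : ~ countable [set: R].
Proof.
move=> /countable_lebesgue_measure0; rewrite -set_itvNyy lebesgue_measure_itv.
by [].
Qed.

(** * Sufficiency and the equivalence *)

Unset Implicit Arguments.

Theorem corollary14 (R : realType) (k : scalar_kind) (p : R) (p1 : 1 <= p)
    (w : nat -> scalar_field R k) (hw : bounded_weights w) :
  li_yorke_chaotic (weighted_shift p1 hw) <->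
  ereal_sup [set (sabs (\prod_(ij.1 <= l < ij.2.+1) w l))%:E
            | ij in [set ij : nat * nat | (ij.1 <= ij.2)%N]] = +oo%E.
Proof.
split; first exact: li_yorke_chaotic_products_unbounded.
move=> sup_oo; split; first exact: continuous_weighted_shift.
have [M M1 wM] : exists2 M : R, 1 <= M & forall n, sabs (w n) <= M.
  have [M wM] := hw; exists (Num.max 1 M) => [|n].
    by rewrite le_max lexx.
  by rewrite le_max wM orbT.
have unbounded A : exists2 ij : nat * nat, (ij.1 <= ij.2)%N &
    A <= sabs (\prod_(ij.1 <= l < ij.2.+1) w l).
  have : (A%:E < +oo)%E by exact: ltry.
  rewrite -sup_oo => /ereal_sup_gt [_ [ij ij_le <-]].
  by rewrite lte_fin => /ltW; exists ij.
have [x [sum_x decay recur]] := irregular_sequence M1 wM unbounded.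
have x_lp : x \in lp_mem p.
  by apply/lp_memP; apply: le_lt_trans (lp_enorm_le_sum p1 sum_x) (ltry _).
pose X : lp k p1 := Lp p1 x_lp.
pose B := weighted_shift p1 hw.
(* By linearity, the norms of the single orbit of [X] govern all distances. *)
have distE a b n : mdist (iter n B (real_scalar k a *: X))
    (iter n B (real_scalar k b *: X)) = `|a - b| * lp_norm (iter n B X).
  rewrite mdist_iter_weighted_shift -scalerBl -real_scalarB.
  by rewrite iter_weighted_shiftZ lp_normZ sabs_real_scalar.
have norm_ge0 n : 0 <= lp_norm (iter n B X) by rewrite -lp_normE normr_ge0.
(* An iterate of [X] has an entry 1, so [X] is nonzero; this makes [a] recoverable from [a *: X]. *)
have X0 : lp_norm X != 0.
  apply/eqP => /lp_norm_eq0 X0; have [t _ [i prodx]] := recur 0%N.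
  have := oner_neq0 (scalar_field R k); rewrite -prodx.
  by rewrite (_ : x (i + t)%N = X (i + t)%N)// X0 mulr0 eqxx.
exists (range (fun a => real_scalar k a *: X)); split.
  move=> cS; apply: (@real_uncountable R).
  have inj_X : {in [set: R] &, injective (fun a => real_scalar k a *: X)}.
    move=> a b _ _ /eqP.
    rewrite -subr_eq0 -scalerBl -real_scalarB => /eqP.
    move/(congr1 (fun z => lp_norm z)).
    rewrite lp_normZ sabs_real_scalar -(lp_normE (0 : lp k p1)) normr0 => /eqP.
    by rewrite mulf_eq0 (negPf X0) orbF normr_eq0 subr_eq0 => /eqP.
  by rewrite -(eq_countable (inj_card_eq inj_X)).
move=> _ _ [a _ <-] [b _ <-] ab.
have ab0 : 0 < `|a - b|.
  by rewrite normr_gt0 subr_eq0; apply: contra_notN ab => /eqP ->.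
under eq_fun do rewrite distE; split.
  apply: limn_einf_eq0 => [n|n e e0]; first by rewrite mulr_ge0.
  (* The first argument places [r] beyond [n]; the second makes [2^c] exceed [2 |a - b| / e]. *)
  pose c := maxn n (Num.bound (e^-1 * (`|a - b| * 2))).
  have [r cr sum_r] := decay c; exists r.
    by rewrite (leq_trans _ cr)// leq_maxl.
  have norm_r : lp_norm (iter r B X) <= 2 * 2^-1 ^+ c.
    rewrite -lee_fin lp_normK; apply: lp_enorm_le_sum => // N.
    by under eq_bigr do rewrite iter_weighted_shiftE.
  apply: le_trans (ler_wpM2l (ltW ab0) norm_r) _.
  rewrite mulrA exprVn ler_pdivrMr ?exprn_gt0// -ler_pdivrMl//.
  by rewrite ltW// upper_nthrootP// leq_maxr.
(* An entry 1 in [B^t X] forces its norm to be at least 1, hence the distance to be at least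
   [|a - b|]. *)
apply: lt_le_trans (limn_esup_ge (c := `|a - b|) _); first by rewrite lte_fin.
move=> n; have [t nt [i prodx]] := recur n; exists t => //.
rewrite ler_peMr// (le_trans _ (sabs_le_lp_norm (iter t B X) i))//.
by rewrite iter_weighted_shiftE prodx sabs1.
Qed.
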